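(* For every convergence $\xi$, $$\mathrm{S}_1\mathrm{P}_1^{\mathbb{U}}\xi=\mathrm{S}_0\xi .$$
   Context: Filters on $X$ are families of nonempty subsets closed under finite intersections and supersets, ordered by inclusion ($\leq$); $\bigwedge$ is intersection. Two families of sets mesh, $\mathcal{A}\#\mathcal{B}$, if $A\cap B\neq\emptyset$ for all $A\in\mathcal{A},B\in\mathcal{B}$. A filter is principal if it consists of all supersets of some nonempty set, and countably based if it has a countable filter-base. A convergence $\xi$ on $X$ is a relation between points and filters, written $x\in\lim_\xi\mathcal{F}$, such that $x\in\lim_\xi\{x\}^{\uparrow}$ for all $x$ (where $\{x\}^\uparrow$ is the principal ultrafilter of $x$), and $\mathcal{F}\subset\mathcal{G}$ implies $\lim_\xi\mathcal{F}\subset\lim_\xi\mathcal{G}$. The adherence of a filter $\mathcal{H}$ is $\mathrm{adh}_\xi\mathcal{H}=\bigcup_{\mathcal{F}\#\mathcal{H}}\lim_\xi\mathcal{F}$ (union over filters $\mathcal{F}$ on $X$). For a convergence $\theta$, $\mathrm{S}_1\theta$ (resp. $\mathrm{S}_0\theta$) is the convergence in which the limit of a filter $\mathcal{F}$ is $\bigcap\{\mathrm{adh}_\theta\mathcal{D}:\mathcal{D}\#\mathcal{F}\}$, where $\mathcal{D}$ ranges over all countably based (resp. principal) filters on the underlying set. $\mathrm{P}_1^{\mathbb{U}}\xi$ is the convergence given by: $x\in\lim_{\mathrm{P}_1^{\mathbb{U}}\xi}\mathcal{F}$ iff there is a countable set $\mathbb{D}$ of ultrafilters on $X$, each converging to $x$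 for $\xi$, with $\mathcal{F}\geq\bigwedge_{\mathcal{U}\in\mathbb{D}}\mathcal{U}$. *)

(* Defs.v *)
From mathcomp Require Import all_boot.
From mathcomp Require Import boolp classical_sets cardinality filter.

Set Implicit Arguments.
Unset Strict Implicit.
Unset Printing Implicit Defensive.

Local Open Scope classical_set_scope.

(* Filters are required to be proper, i.e. all their members are nonempty;
   hence [pfilter_on] rather than [filter_on] throughout. *)

Definition point_filter (X : Type) (x : X) : pfilter_on X :=
  PFilterPack (principal_filter x) (principal_filter_proper x).

Record convergence (X : Type) := Convergence {
  lim_conv : pfilter_on X -> set X;
  conv_point : forall x : X, lim_conv (point_filter x) x;
  conv_mono : forall F G : pfilter_on X,
    F `<=` G -> lim_conv F `<=` lim_conv G
}.

Definition adh (X : Type) (xi : convergence X) (H : pfilter_on X) : set X :=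
  \bigcup_(F in [set F : pfilter_on X | F `#` H]) lim_conv xi F.

Definition principal (X : Type) : set (pfilter_on X) :=
  [set D : pfilter_on X | exists2 A : set X, A !=set0 & D = globally A :> set_system X].

Definition countably_based (X : Type) : set (pfilter_on X) :=
  [set D : pfilter_on X | exists2 B : set_system X,
             countable B & D = filter_from B id :> set_system X].

Section AdherenceModification.
Variables (X : Type) (J : set (pfilter_on X)) (theta : convergence X).

Definition adh_lim (F : pfilter_on X) : set X :=
  \bigcap_(D in [set D : pfilter_on X | J D /\ D `#` F]) adh theta D.

Lemma adh_lim_point (x : X) : adh_lim (point_filter x) x.
Proof.
move=> D [_ Dx]; exists (point_filter x); last exact: conv_point.
by rewrite /= meetsC.
Qed.

Lemma adh_lim_mono (F G : pfilter_on X) :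
  F `<=` G -> adh_lim F `<=` adh_lim G.
Proof.
by move=> FG x Fx D [JD DG]; apply: Fx; split=> //; exact: meetsSr FG DG.
Qed.

Definition adh_mod : convergence X := Convergence adh_lim_point adh_lim_mono.

End AdherenceModification.

Definition S0 (X : Type) (theta : convergence X) : convergence X :=
  adh_mod (@principal X) theta.

Definition S1 (X : Type) (theta : convergence X) : convergence X :=
  adh_mod (@countably_based X) theta.

Section CountableUltrafilterModification.
Variables (X : Type) (xi : convergence X).

(* The empty family [DD] never contributes: the empty intersection contains
   the empty set, so it is not below a proper filter. *)
Definition P1U_lim (F : pfilter_on X) : set X :=
  [set x | exists DD : set (pfilter_on X),
     [/\ countable DD,
         forall U, DD U -> UltraFilter U /\ lim_conv xi U x
       & \bigcap_(U in DD) (U : set_system X) `<=` F]].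

Lemma P1U_lim_point (x : X) : P1U_lim (point_filter x) x.
Proof.
exists [set point_filter x]; split; first exact: countable1.
- move=> U ->; split; [exact: principal_filter_ultra | exact: conv_point].
- by move=> A; apply.
Qed.

Lemma P1U_lim_mono (F G : pfilter_on X) :
  F `<=` G -> P1U_lim F `<=` P1U_lim G.
Proof.
move=> FG x [DD [cDD UDD DDF]]; exists DD; split=> //.
exact: subset_trans DDF FG.
Qed.

Definition P1U : convergence X := Convergence P1U_lim_point P1U_lim_mono.

End CountableUltrafilterModification.

(* Main.v *)
(* If [x] lies in the limit of [F] for [S0 xi] and [D] is a filter with a
   countable base meshing with [F], then for each [B] in the base some
   ultrafilter containing [B] converges to [x].  The intersection of these
   countably many ultrafilters converges to [x] for [P1U xi] and meshes with
   [D].  Conversely, if a filter finer than an intersection of ultrafilters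
   meshes with a set [A], then one of these ultrafilters contains [A]. *)
Require Import Defs.
From mathcomp Require Import all_boot.
From mathcomp Require Import boolp classical_sets cardinality filter.

Set Implicit Arguments.
Unset Strict Implicit.
Unset Printing Implicit Defensive.

Local Open Scope classical_set_scope.

Lemma convergence_ext (X : Type) (xi theta : convergence X) :
  (forall F, lim_conv xi F = lim_conv theta F) -> xi = theta.
Proof.
case: xi theta => [l lp lm] [l' lp' lm'] /= /funext ll'.
(* With the limit maps identified, the axioms are proofs of the same propositions, equal by proof
   irrelevance. *)
rewrite -{}ll' in lp' lm' *.
by rewrite (Prop_irrelevance lp lp') (Prop_irrelevance lm lm').
Qed.

(** Meshing makes the sets [A.1]&[A.2] a base of a proper filter finer than both, which extends to
    an ultrafilter. *)
Lemma meets_ultra (X : Type) (F G : set_system X) :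
  ProperFilter F -> ProperFilter G -> F `#` G ->
  exists U : set_system X, [/\ UltraFilter U, F `<=` U & G `<=` U].
Proof.
move=> FF FG FmG.
pose H := filter_from (F `*` G) (fun AB => AB.1 `&` AB.2).
have HH : ProperFilter H.
  apply: filter_from_proper => [|[A B] [/= FA GB]]; last exact: FmG.
  apply: filter_from_filter; first by exists (setT, setT); split; exact: filterT.
  move=> [A B] [A' B'] [/= FA GB] [/= FA' GB'].
  exists (A `&` A', B `&` B'); first by split; exact: filterI.
  by rewrite /= setIACA.
have [U [UU HU]] := ultraFilterLemma HH.
exists U; split=> // A A_in; apply: HU.
- by exists (A, setT); [split=> //; exact: filterT | exact: subIsetl].
- by exists (setT, A); [split=> //; exact: filterT | exact: subIsetr].
Qed.

(** An ultrafilter finer than both [H] and the filter witnessing adherence inherits the limit by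
    monotonicity. *)
Lemma adh_ultra (X : Type) (xi : convergence X) (H : pfilter_on X) (x : X) :
  adh xi H x ->
  exists U : pfilter_on X, [/\ UltraFilter U, H `<=` U & lim_conv xi U x].
Proof.
move=> [F /= FH Fx].
have [U [UU FU HU]] := meets_ultra (pfilter_class F) (pfilter_class H) FH.
exists (PFilterPack U ultra_proper); split=> //.
exact: conv_mono Fx.
Qed.

Lemma bigcap_ultra_meets (X : Type) (DD : set (pfilter_on X))
    (F : set_system X) (A : set X) :
  (forall U, DD U -> UltraFilter U) ->
  \bigcap_(U in DD) (U : set_system X) `<=` F -> F `#` globally A ->
  exists2 U, DD U & (U : pfilter_on X) A.
Proof.
move=> DDultra DDF FA; apply: contrapT => nA.
(* If every [U] misses [A], all contain its complement, so [F] does too and cannot mesh with [A]. *)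
have /DDF FCA : (\bigcap_(U in DD) (U : set_system X)) (~` A).
  move=> U DU; have [UA|//] := in_ultra_setVsetC A (DDultra U DU).
  by case: nA; exists U.
by have [y []] := FA _ A FCA (fun=> id).
Qed.

Lemma principal_countably_based (X : Type) :
  @principal X `<=` @countably_based X.
Proof.
move=> D [A _ DA]; exists [set A]; first exact: countable1.
rewrite [LHS]DA eqEsubset; split=> B; first by move=> AB; exists A.
by move=> [_ -> AB].
Qed.

Lemma adh_P1U_principal (X : Type) (xi : convergence X) (D : pfilter_on X) :
  principal D -> adh (P1U xi) D `<=` adh xi D.
Proof.
move=> [A _ DA] x [G /= GD [DD [_ DDx DDG]]].
have {}DA : pfilter D = globally A by [].
rewrite DA in GD.
have DDultra U : DD U -> UltraFilter U by move=> /DDx[].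
have [U DU UA] := bigcap_ultra_meets DDultra DDG GD.
exists U; last by have [] := DDx U DU.
rewrite /= DA meets_globallyr => B UB.
by apply: (@filter_ex _ U); exact: filterI.
Qed.

Lemma countably_based_adh_P1U (X : Type) (xi : convergence X)
    (D : pfilter_on X) (B : set_system X) (x : X) :
  countable B -> D = filter_from B id :> set_system X ->
  (forall A, B A ->
    exists U : pfilter_on X, [/\ UltraFilter U, U A & lim_conv xi U x]) ->
  adh (P1U xi) D x.
Proof.
move=> cB DB Bx; have {}DB : pfilter D = filter_from B id by [].
have [u uP] : {u : set X -> pfilter_on X & forall A, B A ->
    [/\ UltraFilter (u A), u A A & lim_conv xi (u A) x]}.
  apply: (@choice _ _ (fun A (U : pfilter_on X) => B A ->
    [/\ UltraFilter U, U A & lim_conv xi U x])) => A.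
  have [/Bx[U UP]|nBA] := pselect (B A); first by exists U.
  (* Outside [B] the choice is arbitrary; [D] serves as a default. *)
  by exists D => /nBA.
pose G : set_system X := \bigcap_(U in u @` B) (U : set_system X).
(* The base is nonempty, so [G] lies below the proper filter [u A0] and is itself proper. *)
have [A0 BA0 _] : filter_from B id setT by rewrite -DB; exact: filterT.
have GF : Filter G.
  split=> [U _|P Q GP GQ U uU|P Q PQ GP U uU]; first exact: filterT.
    by apply: filterI; [exact: GP | exact: GQ].
  exact: filterS PQ (GP U uU).
have GN0 : ~ G set0.
  by move=> /(_ (u A0)) /(_ (ex_intro2 _ _ _ BA0 erefl)); exact: filter_not_empty.
exists (PFilterType G GN0) => /=.
- rewrite DB => P Q GP [A BA AQ].
  have [_ uA _] := uP A BA.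
  have uAP : u A P by apply: GP; exists A.
  apply: (@filter_ex _ (u A)).
  by apply: filterI => //; exact: filterS AQ uA.
- exists (u @` B); split=> //.
  + by apply: sub_countable cB; exact: card_image_le.
  + by move=> _ [A /uP[uU _ ux] <-].
Qed.

Theorem theorem21 (X : Type) (xi : convergence X) : S1 (P1U xi) = S0 xi.
Proof.
apply: convergence_ext => F; rewrite eqEsubset; split=> x Fx.
- move=> D [pD DF]; apply: (adh_P1U_principal pD); apply: Fx.
  by split=> //; exact: principal_countably_based.
- move=> D [[B cB DB] DF]; apply: (countably_based_adh_P1U cB DB) => A BA.
  have DA : D A by have -> : pfilter D = filter_from B id by []; exists A.
  have [y Ay] := filter_ex DA.
  (* The principal filter of [A] is coarser than [D], so it still meshes with [F] and can be tested
     in [S0 xi]. *)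
  pose pA := PFilterPack (globally A) (globally_properfilter Ay).
  have pAF : pA `#` F.
    by apply: meetsSl DF => C sAC; exact: filterS sAC DA.
  have pApr : principal pA by exists A; first by exists y.
  have [U [UU AU Ux]] := adh_ultra (Fx pA (conj pApr pAF)).
  by exists U; split=> //; exact: AU.
Qed.
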